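(* Let $k$ be a non-negative integer and let $S$ be a finite non-empty subset of an abelian group $G$ that is not a coset of a subgroup and satisfies $\kappa_1(S)\le |S|-2$ (so that the sub-atom of $S$ is defined). Let $M$ be the sub-atom of $S$. If $|kS|\le k|S|-k$, then $kS+M=kS$.
   Context: Notation: $A+B=\{a+b: a\in A,\ b\in B\}$ and $kS=S+\cdots+S$ ($k$ summands; $0S=\{0\}$). For a finite non-empty $A\subset G$ let $K_A$ be the subgroup generated by $A-A$; fix $a\in A$. If $A$ is not a coset of $K_A$, put $$\kappa_1(A)=\min\{|X+A|-|X| : X\subset K_A \text{ finite non-empty},\ X+(A-a)\neq K_A\}$$ (this does not depend on $a$). A ($1$-)fragment of $A$ is a finite non-empty set $X\subset K_A$ with $X+(A-a)\neq K_A$ and $|X+A|-|X|=\kappa_1(A)$. A ($1$-)atom of $A$ is a $1$-fragment of minimum cardinality. It is known that there is a unique $1$-atom of $A$ containing $0$, and that it is a finite subgroup; denote it $H(A)$. For a subgroup $H$, an $H$-component of $A$ is a non-empty set of the form $A\cap(x+H)$. An $H(A)$-component $A'$ of $A$ is called desertic if $|A'|\le |H(A)|/2$. Such a component is unique if it exists, and $A$ is called a desert if it has a desertic component. Let $A$ be such that $\kappa_1(A)\le |A|-2$. The desert sequence $A_0,\dots,A_\ell$ of $A$, with associated subgroups $H_i=H(A_i)$, is defined as follows: $A_0=A$; as long as $A_i$ is a desert, $A_{i+1}$ is the desertic $H_i$-component of $A_i$; the sequence stops at the first $A_\ell$ that is not a desert. (At each step $A_i$ is not a coset of $K_{A_i}$,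 so $H_i$ is well defined, and the sequence is finite.) The sub-atom of $A$ is $M=H_\ell$ if $H_\ell\neq\{0\}$, and $M=H_{\ell-1}$ otherwise; it is a non-zero subgroup. *)

(* Defs.v *)
From HB Require Import structures.
From mathcomp Require Import all_boot all_order all_algebra.
From mathcomp Require Import finmap.
From mathcomp Require Import boolp classical_sets.

Set Implicit Arguments.
Unset Strict Implicit.
Unset Printing Implicit Defensive.

Import GRing.Theory.

Local Open Scope classical_set_scope.
Local Open Scope fset_scope.
Local Open Scope ring_scope.
Local Open Scope nat_scope.

Section Definitions.
Variable G : zmodType.
Implicit Types (A B X Y : {fset G}) (a x y : G).

Definition sumset A B : {fset G} := [fset (a + b)%R | a in A, b in B].

Definition ksumset k A : {fset G} := iter k (sumset A) [fset 0%R].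

Definition translate x A : {fset G} := [fset (x + a)%R | a in A].

Definition is_subgroup (H : set G) : Prop :=
  H 0%R /\ (forall x y, H x -> H y -> H (x - y)%R).

Definition is_coset_of (H : set G) A : Prop :=
  exists x, [set` A] = [set (x + h)%R | h in H].

Definition diffgroup A : set G :=
  smallest is_subgroup [set (x - y)%R | x in [set` A] & y in [set` A]].

(* The sets over which the minimum defining kappa1 is taken.  The condition   *)
(* does not depend on the choice of a in A: see admissible_any.               *)
Definition admissible A X : Prop :=
  [/\ X != fset0,
      ([set` X] `<=` diffgroup A)%classic
    & exists2 a, a \in A &
        [set` sumset X (translate (- a)%R A)] <> diffgroup A].

(* For non-empty A one has #|` X| <= #|` sumset X A|, so the truncated        *)
(* subtraction is the true difference.                                        *)
Definition excess A X : nat := #|` sumset X A| - #|` X|.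

(* The default values of xget below are irrelevant: when A is non-empty and   *)
(* not a coset of diffgroup A, the minimum and the atom containing 0 exist.   *)
Definition kappa1 A : nat :=
  xget 0 [set n | (exists2 X, admissible A X & n = excess A X) /\
                  (forall X, admissible A X -> n <= excess A X)].

Definition fragment A X : Prop := admissible A X /\ excess A X = kappa1 A.

Definition atom A X : Prop :=
  fragment A X /\ (forall Y, fragment A Y -> #|` X| <= #|` Y|).

Definition atom0 A : {fset G} := xget fset0 [set X | atom A X /\ 0%R \in X].

Definition component (H : {fset G}) A B : Prop :=
  B != fset0 /\ exists x, B = A `&` translate x H.

Definition desertic A B : Prop :=
  component (atom0 A) A B /\ 2 * #|` B| <= #|` atom0 A|.

Definition desert A : Prop := exists B, desertic A B.

Definition desertic_component A : {fset G} := xget A [set B | desertic A B].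

(* Only the terms of index at most desert_len A belong to the sequence.       *)
Definition desert_seq A (i : nat) : {fset G} := iter i desertic_component A.

Definition desert_len A : nat :=
  xget 0 [set l | ~ desert (desert_seq A l) /\
                  (forall i, i < l -> desert (desert_seq A i))].

(* If kappa1 A <= #|` A| - 2 then atom0 A != [fset 0], so the second branch   *)
(* is only reached with desert_len A > 0.                                     *)
Definition subatom A : {fset G} :=
  let l := desert_len A in
  if atom0 (desert_seq A l) != [fset 0%R] then atom0 (desert_seq A l)
  else atom0 (desert_seq A l.-1).

Lemma diffgroup_subgroup A : is_subgroup (diffgroup A).
Proof.
split=> [|x y Kx Ky] H HH; first by case: HH => [[]].
by case: (HH) => [[_ HB] _]; apply: HB; [apply: Kx | apply: Ky].
Qed.

Lemma admissible_any A X a :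
    a \in A -> X != fset0 -> ([set` X] `<=` diffgroup A)%classic ->
  admissible A X <->
    [set` sumset X (translate (- a)%R A)] <> diffgroup A.
Proof.
move=> aA X0 sX; split=> [[_ _ [b bA neq]] eqa|]; last by split=> //; exists a.
apply: neq; have [K0 KB] := diffgroup_subgroup A.
have KD x y : diffgroup A x -> diffgroup A y -> diffgroup A (x + y)%R.
  by move=> Kx Ky; rewrite -[y]opprK -[(- y)%R]sub0r; apply: (KB) => //; apply: KB.
have Kdif x y : x \in A -> y \in A -> diffgroup A (x - y)%R.
  by move=> xA yA H /= [_]; apply; exists x => //; exists y.
rewrite eqEsubset; split=> [z /imfset2P[/= x xX [y /imfsetP[/= c cA ->] ->]]|z Kz].
  by apply: KD; [apply: sX | rewrite addrC; apply: Kdif].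
have : diffgroup A (z - (a - b))%R by apply: KB => //; apply: Kdif.
rewrite -eqa => /imfset2P[/= x xX [y /imfsetP[/= c cA ->] e]].
apply/imfset2P; exists x => //; exists (- b + c)%R; first by apply/imfsetP; exists c.
have -> : z = (x + (- a + c) + (a - b))%R by rewrite -e subrK.
by rewrite -addrA addrACA addNr add0r [(c - b)%R]addrC.
Qed.

End Definitions.

(* Main.v *)
Require Import Defs.
From HB Require Import structures.
From mathcomp Require Import all_boot all_order all_algebra.
From mathcomp Require Import finmap zify.
From mathcomp Require Import boolp classical_sets.

Set Implicit Arguments.
Unset Strict Implicit.
Unset Printing Implicit Defensive.

Import GRing.Theory.

Local Open Scope fset_scope.
Local Open Scope nat_scope.

(* Submodularity of X |-> |X + A|, together with the duality sending X to the *)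
(* negative of the complement of X + A, shows that distinct atoms of A are    *)
(* disjoint; hence the atom H containing 0 is a subgroup.  If A is not a      *)
(* desert, two components of A always add up to a full coset of H.  If A has  *)
(* a desertic component B, contained in x + H, the few holes of A force every *)
(* sum of k terms not all in B to come with its whole coset of H, so only kB  *)
(* matters.  If kx + H is reached by another sum, kA is H-periodic; otherwise *)
(* the isoperimetric inequality gives |kA + H| >= |H| + k kappa1(A), which    *)
(* leaves |kB| <= k|B| - k, and B - B generates H, so the argument can be     *)
(* repeated with B.  When the atom of B is trivial, the isoperimetric         *)
(* inequality in B shows that kB is a full coset of H.                        *)

(** One count drives the proof. Let H be the atom of A containing 0 and kappa its excess. If H is
    not {0}, then |H + A| = |H| + kappa <= |H| + |A| - 2 ([leq_excess_atom0]), so A has at most |H|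
    - 2 holes in H + A. Two components with more than |H| elements in all add up to a full coset of
    H ([sumset_components]). This makes kA periodic when A is not a desert ([ndesert_ksumset]), and
    otherwise makes the sums with a term outside the desertic component B periodic
    ([ksumset_outer_periodic]).

    If no such sum meets kx + H, the smallness of kA passes to kB: outside kx + H, kA coincides with
    H + kA and has at least k kappa elements ([leq_card_ksumset_atom0]), while A has at most kappa
    elements outside B, so that subtracting gives |kB| <= k|B| - k ([uniq_sum_card]). The induction
    [subatom_ksumset] then follows the desert sequence: [desertic_ksumset] carries a period of kB
    back to kA, [diffgroup_desertic] places the sub-atom of B inside H, and a trivial atom at the
    end is handled by [atom0_trivial_ksumset]. *)

Lemma leq_cardD (T : choiceType) (X Y Z : {fset T}) :
    X `<=` Z -> Y `<=` Z -> (forall z, z \in X -> z \in Y -> False) ->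
  #|` X| + #|` Y| <= #|` Z|.
Proof.
move=> sXZ sYZ dXY; rewrite -cardfsUI.
have -> : X `&` Y = fset0.
  by apply/eqP/fset0Pn => -[z]; rewrite inE => /andP[/dXY].
by rewrite cardfs0 addn0 fsubset_leq_card // fsubUset sXZ.
Qed.

Lemma leq_cardU (T : choiceType) (X Y Z : {fset T}) :
  Z `<=` X `|` Y -> #|` Z| <= #|` X| + #|` Y|.
Proof. by move=> /fsubset_leq_card; rewrite -cardfsUI; lia. Qed.

Lemma card_fset_image (T U : choiceType) (f : T -> U) (X : {fset T}) :
  injective f -> #|` [fset f x | x in X]| = #|` X|.
Proof. by move=> f_inj; rewrite card_imfset. Qed.

(** * Sumsets, translates and admissible sets *)

Section Sumsets.
Variable G : zmodType.
Implicit Types (A B X Y Z H : {fset G}) (a b x y z : G).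

Lemma sumsetP X Y z :
  reflect (exists x y, [/\ x \in X, y \in Y & z = (x + y)%R])
          (z \in sumset X Y).
Proof.
apply: (iffP idP) => [/imfset2P[/= x xX [y yY ->]]|[x [y [xX yY ->]]]].
  by exists x, y.
by apply/imfset2P; exists x => //; exists y.
Qed.

Lemma mem_sumset X Y x y : x \in X -> y \in Y -> (x + y)%R \in sumset X Y.
Proof. by move=> xX yY; apply/sumsetP; exists x, y. Qed.

Lemma sumsetS X X' Y Y' :
  X `<=` X' -> Y `<=` Y' -> sumset X Y `<=` sumset X' Y'.
Proof.
move=> /fsubsetP sX /fsubsetP sY; apply/fsubsetP=> _ /sumsetP[x [y [xX yY ->]]].
by rewrite mem_sumset ?sX ?sY.
Qed.

Lemma mem_translate x X y : (y \in translate x X) = ((y - x)%R \in X).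
Proof.
apply/imfsetP/idP => [[z zX ->]|yX]; first by rewrite addrC addKr.
by exists (y - x)%R => //; rewrite addrC subrK.
Qed.

Lemma card_translate x X : #|` translate x X| = #|` X|.
Proof. by rewrite card_imfset //=; apply: addrI. Qed.

Lemma sumset_translatel t X Y :
  sumset (translate t X) Y = translate t (sumset X Y).
Proof.
apply/fsetP=> z; rewrite mem_translate; apply/sumsetP/sumsetP.
  move=> [x [y [xX yY ->]]]; exists (x - t)%R, y.
  by rewrite -mem_translate addrAC.
move=> [x [y [xX yY e]]]; exists (x + t)%R, y.
by rewrite mem_translate addrK addrAC -e subrK.
Qed.

Lemma sumsetUl X Y A : sumset (X `|` Y) A = sumset X A `|` sumset Y A.
Proof.
apply/fsetP=> z; rewrite inE; apply/sumsetP/orP.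
  move=> [x [a [xXY aA ->]]]; move: xXY; rewrite inE.
  by case/orP=> ?; [left|right]; apply: mem_sumset.
by case=> /sumsetP[x [a [xX aA ->]]]; exists x, a; rewrite inE xX ?orbT.
Qed.

Lemma leq_card_sumset X A : A != fset0 -> #|` X| <= #|` sumset X A|.
Proof.
case/fset0Pn=> a aA; rewrite -(card_translate a).
apply/fsubset_leq_card/fsubsetP=> z; rewrite mem_translate => zX.
by rewrite -[z](subrK a) mem_sumset.
Qed.

Lemma card_sumset_submod X Y A :
  #|` sumset (X `|` Y) A| + #|` sumset (X `&` Y) A|
    <= #|` sumset X A| + #|` sumset Y A|.
Proof.
rewrite sumsetUl -[in leqRHS]cardfsUI leq_add2l fsubset_leq_card //.
by rewrite fsubsetI !sumsetS ?fsubsetIl ?fsubsetIr.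
Qed.

Section Subgroup.
Variable K : set G.
Hypothesis subK : is_subgroup K.

Lemma subgroup0 : K 0%R. Proof. by case: subK. Qed.

Lemma subgroupB x y : K x -> K y -> K (x - y)%R.
Proof. by case: subK => _; apply. Qed.

Lemma subgroupN x : K x -> K (- x)%R.
Proof. by move=> Kx; rewrite -sub0r; apply: subgroupB => //; apply: subgroup0. Qed.

Lemma subgroupD x y : K x -> K y -> K (x + y)%R.
Proof. by move=> Kx Ky; rewrite -[y]opprK; apply/subgroupB/subgroupN. Qed.

End Subgroup.

Lemma diffgroupB A x y : x \in A -> y \in A -> diffgroup A (x - y)%R.
Proof. by move=> xA yA H /= [_]; apply; exists x => //; exists y. Qed.

Lemma diffgroup_sub A (H : set G) :
    is_subgroup H -> (forall x y, x \in A -> y \in A -> H (x - y)%R) ->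
  (diffgroup A `<=` H)%classic.
Proof.
by move=> sH dH z; apply; split=> // _ [x xA [y yA <-]]; apply: dH.
Qed.

(** X + (A - a) always lies in the difference group, so differing from it means missing a point of
    it. *)
Lemma admissibleP A X a : a \in A ->
  admissible A X <->
    [/\ X != fset0, ([set` X] `<=` diffgroup A)%classic
      & exists2 g, diffgroup A g & (a + g)%R \notin sumset X A].
Proof.
move=> aA; split=> [adm|[X0 sX [g Kg gN]]]; last first.
  apply/(admissible_any aA X0 sX) => e; move: Kg; rewrite -e /=.
  case/sumsetP=> x [y [xX]]; rewrite mem_translate opprK => yA ge.
  case/negP: gN; rewrite ge addrCA [(a + y)%R]addrC.
  exact: mem_sumset.
have [X0 sX _] := adm; split=> //.
move/(admissible_any aA X0 sX): adm => neq; apply: contrapT => allK.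
have subK := diffgroup_subgroup A.
apply: neq; rewrite eqEsubset; split=> z /=.
  case/sumsetP=> x [y [xX]]; rewrite mem_translate opprK => yA ->.
  by apply: (subgroupD subK); [apply: sX | rewrite -(addrK a y); apply: diffgroupB].
move=> Kz; have : (a + z)%R \in sumset X A.
  by apply/negPn/negP=> zN; apply: allK; exists z.
case/sumsetP=> x [y [xX yA e]]; apply/sumsetP; exists x, (y - a)%R.
by rewrite mem_translate opprK subrK addrA -e addrC addKr.
Qed.

End Sumsets.
Lemma ex_argmin (T : Type) (P : T -> Prop) (f : T -> nat) :
  (exists x, P x) -> exists2 x, P x & forall y, P y -> f x <= f y.
Proof.
move=> [x0 Px0]; pose Q n := `[< exists2 x, P x & f x = n >].
have exQ : exists n, Q n by exists (f x0); apply/asboolP; exists x0.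
case: (ex_minnP exQ) => _ /asboolP[x Px <-] min_x; exists x => // y Py.
by apply: min_x; apply/asboolP; exists y.
Qed.

(** * Atoms and the isoperimetric inequality *)

Section Atoms.
Variables (G : zmodType) (A : {fset G}).
Hypothesis A_neq0 : A != fset0.
Hypothesis A_ncoset : ~ is_coset_of (diffgroup A) A.
Implicit Types (X Y Z : {fset G}) (a b x y z : G).

Let subK : is_subgroup (diffgroup A) := diffgroup_subgroup A.

Lemma card_sumset_excess X : #|` sumset X A| = #|` X| + excess A X.
Proof. by rewrite /excess subnKC // leq_card_sumset. Qed.

Lemma admissible_sub X Y :
  Y != fset0 -> Y `<=` X -> admissible A X -> admissible A Y.
Proof.
have [a aA] := fset0Pn _ A_neq0.
move=> Y0 /[dup] /fsubsetP sYX sYX' /(admissibleP _ aA)[_ sX [g Kg gN]].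
apply/(admissibleP _ aA); split=> //; first by move=> y /sYX; apply: sX.
by exists g => //; apply: contraNN gN; apply: fsubsetP; apply: sumsetS.
Qed.

Lemma admissible_fset1 : admissible A [fset 0%R].
Proof.
have [a aA] := fset0Pn _ A_neq0.
apply/(admissibleP _ aA); split.
- by apply/fset0Pn; exists 0%R; rewrite inE.
- by move=> x /=; rewrite inE => /eqP->; apply: subgroup0 subK.
apply: contrapT => allK; apply: A_ncoset; exists a; rewrite eqEsubset.
split=> [x /= xA|_ [g Kg <-]] /=.
  by exists (x - a)%R; [apply: diffgroupB | rewrite addrC subrK].
apply/negPn/negP=> gN; apply: allK; exists g => //; apply: contraNN gN.
by case/sumsetP=> x [y []]; rewrite inE => /eqP-> yA ->; rewrite add0r.
Qed.

Lemma admissible_translate t X :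
  diffgroup A t -> admissible A X -> admissible A (translate t X).
Proof.
have [a aA] := fset0Pn _ A_neq0.
move=> Kt /(admissibleP _ aA)[/fset0Pn[x xX] sX [g Kg gN]].
apply/(admissibleP _ aA); split.
- by apply/fset0Pn; exists (x + t)%R; rewrite mem_translate addrK.
- move=> y /=; rewrite mem_translate => /sX Ky.
  by rewrite -[y](subrK t); exact: (subgroupD subK Ky Kt).
exists (g + t)%R; first exact: (subgroupD subK).
by rewrite sumset_translatel mem_translate addrA addrK.
Qed.

Lemma excess_translate t X : excess A (translate t X) = excess A X.
Proof. by rewrite /excess sumset_translatel !card_translate. Qed.

Lemma kappa1P : (exists2 X, admissible A X & kappa1 A = excess A X) /\
                (forall X, admissible A X -> kappa1 A <= excess A X).
Proof.
have [|X admX minX] := @ex_argmin _ (admissible A) (excess A).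
  by exists [fset 0%R]; apply: admissible_fset1.
rewrite /kappa1; set P := [set n | _]%classic.
suff : exists n, P n by move/(xgetPex 0).
by exists (excess A X); split=> //; exists X.
Qed.

Lemma atom_exists : exists2 X, atom A X & 0%R \in X.
Proof.
have [[X0 admX0 kX0] _] := kappa1P.
have [|X [admX kX] minX] := @ex_argmin _ (fragment A) (fun X => #|` X|).
  by exists X0; split.
have [/fset0Pn[x xX] sX _] := admX.
exists (translate (- x)%R X); last by rewrite mem_translate opprK add0r.
split; last by move=> Y /minX; rewrite card_translate.
split; last by rewrite excess_translate.
by apply: admissible_translate => //; exact: (subgroupN subK (sX _ xX)).
Qed.

(* If distinct atoms X and Y meet, submodularity forces (X `|` Y) + A to fill *)
(* a coset of the difference group K, which is therefore finite and smaller   *)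
(* than 2 |X| + kappa1 A; but the negative of the complement of X + A is then *)
(* a fragment, so that it has at least |X| elements.                          *)
Lemma atom_meet X Y : atom A X -> atom A Y -> X `&` Y != fset0 -> X = Y.
Proof.
move=> [[admX kX] minX] [[admY kY] minY] XY0.
have eXY : #|` X| = #|` Y|.
  by apply/eqP; rewrite eqn_leq minX ?minY //; split.
have [sXY|nXY] := boolP (X `<=` Y).
  by apply/eqP; rewrite eqEfcard sXY eXY /=.
exfalso.
have [a aA] := fset0Pn _ A_neq0.
have ltXY : #|` X `&` Y| < #|` X|.
  apply: fproper_ltn_card; rewrite fproperE fsubsetIl /=.
  by rewrite fsubsetI fsubset_refl.
have admI : admissible A (X `&` Y) by apply: admissible_sub admX => //; apply: fsubsetIl.
(* The intersection is smaller than an atom, so it is not a fragment; submodularity then pushes the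
   excess of the union strictly below [kappa1 A]. *)
have exI : kappa1 A < excess A (X `&` Y).
  rewrite ltn_neqAle kappa1P.2 // andbT; apply/eqP => kI.
  by have := minX _ (conj admI (esym kI)); rewrite leqNgt ltXY.
have submod := card_sumset_submod X Y A.
have cardU := cardfsUI X Y.
rewrite !card_sumset_excess kX kY in submod.
have [sX sY] : ([set` X] `<=` diffgroup A)%classic /\ ([set` Y] `<=` diffgroup A)%classic.
  by case: admX admY => [_ ? _] [_ ? _].
have sU z : z \in X `|` Y -> diffgroup A z.
  by rewrite inE => /orP[/sX|/sY].
have fullU g : diffgroup A g -> (a + g)%R \in sumset (X `|` Y) A.
  move=> Kg; apply/negPn/negP => gN.
  have /kappa1P.2 : admissible A (X `|` Y).
    apply/(admissibleP _ aA); split=> //; last by exists g.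
    by case/fset0Pn: XY0 => z; rewrite inE => /andP[zX _];
       apply/fset0Pn; exists z; rewrite inE zX.
  lia.
pose F := translate (- a)%R (sumset (X `|` Y) A).
have FE z : (z \in F) <-> diffgroup A z.
  rewrite mem_translate opprK; split; last by rewrite addrC => /fullU.
  case/sumsetP=> u [b [/sU Ku bA e]].
  rewrite -[z](addrK a) e -addrA; apply: (subgroupD subK Ku _).
  exact: diffgroupB.
have cF : #|` F| = #|` X `|` Y| + excess A (X `|` Y).
  by rewrite card_translate card_sumset_excess.
pose C := F `\` translate (- a)%R (sumset X A).
have CE z : (z \in C) <-> diffgroup A z /\ (z + a)%R \notin sumset X A.
  rewrite inE mem_translate opprK.
  by split=> [/andP[? /FE]|[/FE-> ->]].
pose Z : {fset G} := [fset (- z)%R | z in C].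
have ZE z : (z \in Z) = ((- z)%R \in C).
  apply/imfsetP/idP => [[y yC ->]|zC]; first by rewrite opprK.
  by exists (- z)%R => //; rewrite opprK.
have cZ : #|` X| + kappa1 A + #|` Z| = #|` F|.
  rewrite [#|` Z|]card_imfset /=; last exact: oppr_inj.
  rewrite -[in LHS]kX -card_sumset_excess -(card_translate (- a)%R).
  have sXF : translate (- a)%R (sumset X A) `<=` F.
    apply/fsubsetP=> z; rewrite !mem_translate; apply: fsubsetP.
    by rewrite sumsetS // fsubsetUl.
  by rewrite cardfsDS // subnKC // fsubset_leq_card.
have ZA_N x : x \in X -> (a - x)%R \notin sumset Z A.
  move=> xX; apply/negP => /sumsetP[z [b [zZ bA e]]].
  move: zZ; rewrite ZE => /CE[_ /negP]; apply.
  have -> : (- z + a = x + b)%R.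
    by rewrite -[a](subrK x) e addrAC addrA addKr addrC.
  exact: mem_sumset.
have ZA_sub z : z \in sumset Z A -> diffgroup A (z - a)%R.
  case/sumsetP=> u [b [uZ bA ->]]; rewrite -addrA.
  apply: (subgroupD subK); last exact: diffgroupB.
  by move: uZ; rewrite ZE => /CE[/(subgroupN subK)]; rewrite opprK.
(* Z + A and a - X are disjoint subsets of a + K, which bounds the excess of Z by [kappa1 A]. *)
have cZA : #|` sumset Z A| + #|` X| <= #|` F|.
  pose U : {fset G} := [fset (a - x)%R | x in X].
  have -> : #|` X| = #|` U|.
    by rewrite card_imfset //=; move=> x y /addrI /oppr_inj.
  rewrite -(card_translate a F); apply: leq_cardD.
  - by apply/fsubsetP=> z /ZA_sub; rewrite mem_translate => /FE.
  - apply/fsubsetP=> _ /imfsetP[x /= xX ->]; rewrite mem_translate.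
    by apply/FE; rewrite addrC addKr; exact: (subgroupN subK (sX _ xX)).
  - by move=> z zZA /imfsetP[x /= xX ze]; case/negP: (ZA_N _ xX); rewrite -ze.
have admZ : admissible A Z.
  apply/(admissibleP _ aA); split.
  - case/(admissibleP _ aA): admX => _ _ [g Kg gN].
    by apply/fset0Pn; exists (- g)%R; rewrite ZE opprK; apply/CE; rewrite addrC.
  - by move=> z /=; rewrite ZE => /CE[/(subgroupN subK)]; rewrite opprK.
  - have [/fset0Pn[x xX] _ _] := admX.
    by exists (- x)%R; [exact: (subgroupN subK (sX _ xX)) | apply: ZA_N].
have kZ := kappa1P.2 _ admZ.
rewrite card_sumset_excess in cZA.
have /minX : fragment A Z by split=> //; lia.
lia.
Qed.

Lemma atom0P : atom A (atom0 A) /\ 0%R \in atom0 A.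
Proof.
have [X atX X0] := atom_exists; rewrite /atom0; set P := [set X | _]%classic.
suff : exists X, P X by move/(xgetPex fset0).
by exists X.
Qed.

(** For y in the atom H, the translate H - y is an atom that meets H in 0, hence equals H. *)
Lemma atom0_subgroup : is_subgroup [set` atom0 A].
Proof.
have [atH H0] := atom0P; have [[admH kH] minH] := atH.
have [_ sH _] := admH.
split=> // x y xH yH /=.
have : atom A (translate (- y)%R (atom0 A)).
  split; last by move=> Y /minH; rewrite card_translate.
  split; last by rewrite excess_translate.
  by apply: admissible_translate => //; exact: (subgroupN subK (sH _ yH)).
move/(atom_meet atH) => ->; first by rewrite mem_translate opprK subrK.
by apply/fset0Pn; exists 0%R; rewrite !inE H0 mem_translate opprK add0r.
Qed.

Lemma atom0_diffgroup x : x \in atom0 A -> diffgroup A x.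
Proof. by have [[[[_ sH _] _] _] _] := atom0P; apply: sH. Qed.

(* The last case says that X + A fills the coset of the difference group      *)
(* which contains it.                                                         *)
Lemma isoperimetric X x a : a \in A -> X != fset0 ->
    (forall y, y \in X -> diffgroup A (y - x)%R) ->
  #|` X| + excess A (atom0 A) <= #|` sumset X A| \/
  (forall g, diffgroup A g -> (x + a + g)%R \in sumset X A).
Proof.
move=> aA /fset0Pn[y yX] sX.
have [admX|nadmX] := pselect (admissible A (translate (- x)%R X)).
  left; rewrite card_sumset_excess leq_add2l.
  rewrite -(excess_translate (- x)%R X) (atom0P.1.1.2).
  exact: kappa1P.2.
right=> g Kg; apply/negPn/negP=> gN; apply: nadmX; apply/(admissibleP _ aA).
split.
- by apply/fset0Pn; exists (y - x)%R; rewrite mem_translate opprK subrK.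
- by move=> z /=; rewrite mem_translate opprK => /sX; rewrite addrK.
- exists g => //; rewrite sumset_translatel mem_translate opprK.
  by rewrite addrAC [(a + x)%R]addrC.
Qed.

Lemma leq_card_atom0 X : admissible A X ->
  excess A X <= excess A (atom0 A) -> #|` atom0 A| <= #|` X|.
Proof.
move=> admX; have [[_ kH] minH] := atom0P.1; rewrite kH => le_k.
by apply: minH; split=> //; apply/eqP; rewrite eqn_leq le_k kappa1P.2.
Qed.

Lemma excess_fset1 : excess A [fset 0%R] = #|` A|.-1.
Proof.
rewrite /excess cardfs1 subn1; congr (_.-1); congr #|` _|.
apply/fsetP=> z; apply/sumsetP/idP => [[x [y []]]|zA].
  by rewrite inE => /eqP-> yA ->; rewrite add0r.
by exists 0%R, z; rewrite inE add0r.
Qed.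

(** Otherwise the excess |A| - 1 of {0} would be minimal, and {0} would be a fragment, leaving an
    atom of one element. *)
Lemma leq_excess_atom0 : atom0 A != [fset 0%R] ->
  excess A (atom0 A) + 2 <= #|` A|.
Proof.
move=> H1; have A1 : 0 < #|` A| by rewrite cardfs_gt0.
rewrite leqNgt; apply/negP=> lt_k.
have := leq_card_atom0 admissible_fset1; rewrite excess_fset1 => leH.
have {}leH : #|` atom0 A| <= 1 by rewrite -(cardfs1 (0%R : G)) leH //; lia.
move/negP: H1; apply; rewrite eq_sym eqEfcard cardfs1 leH andbT.
by rewrite fsub1set atom0P.2.
Qed.

End Atoms.

(** * Iterated sumsets and pigeonhole in cosets *)

Section IteratedSumsets.
Variable G : zmodType.
Implicit Types (A B X Y Z H : {fset G}) (a b x y z : G).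

Lemma sumsetC X Y : sumset X Y = sumset Y X.
Proof.
apply/fsetP=> z; apply/sumsetP/sumsetP => -[x [y [xX yY ->]]];
  by exists y, x; rewrite addrC.
Qed.

Lemma sumsetA X Y Z : sumset X (sumset Y Z) = sumset (sumset X Y) Z.
Proof.
apply/fsetP=> t; apply/sumsetP/sumsetP.
  move=> [x [_ [xX /sumsetP[y [z [yY zZ ->]]] ->]]].
  by exists (x + y)%R, z; rewrite addrA mem_sumset.
move=> [_ [z [/sumsetP[x [y [xX yY ->]]] zZ ->]]].
by exists x, (y + z)%R; rewrite addrA mem_sumset.
Qed.

Lemma ksumsetE k A : ksumset k.+1 A = sumset A (ksumset k A).
Proof. by []. Qed.

Lemma ksumsetS k A B : A `<=` B -> ksumset k A `<=` ksumset k B.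
Proof. by move=> sAB; elim: k => // k IHk; rewrite !ksumsetE sumsetS. Qed.

Lemma mem_ksumset1 A x : x \in A -> x \in ksumset 1 A.
Proof. by move=> xA; rewrite -[x]addr0 mem_sumset // inE. Qed.

(** The pigeonhole arguments consume two summands; the smallness hypothesis provides them. *)
Lemma small_ksumset_gt1 k A :
  #|` ksumset k A| + k <= k * #|` A| -> 1 < k.
Proof.
case: k => [|[|//]]; first by rewrite cardfs1.
have : #|` A| <= #|` ksumset 1 A|; last by lia.
by apply/fsubset_leq_card/fsubsetP=> a; apply: mem_ksumset1.
Qed.

Lemma mem_ksumsetD i j A u v :
  u \in ksumset i A -> v \in ksumset j A -> (u + v)%R \in ksumset (i + j) A.
Proof.
elim: i u => [|i IHi] u; first by rewrite inE => /eqP->; rewrite add0r.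
case/sumsetP=> a [w [aA wA ->]] vA; rewrite addSn ksumsetE -addrA.
by rewrite mem_sumset // IHi.
Qed.

Lemma mem_ksumset_mulrn k A x : x \in A -> (x *+ k)%R \in ksumset k A.
Proof.
move=> xA; elim: k => [|k IHk]; first by rewrite mulr0n inE.
by rewrite mulrS ksumsetE mem_sumset.
Qed.

Lemma ksumset_coset (K : set G) k A x z : is_subgroup K ->
    (forall a, a \in A -> K (a - x)%R) ->
  z \in ksumset k A -> K (z - x *+ k)%R.
Proof.
move=> subK sA; elim: k z => [|k IHk] z.
  by rewrite inE => /eqP->; rewrite mulr0n subrr; apply: subgroup0.
case/sumsetP=> a [w [/sA Ka /IHk Kw ->]]; rewrite mulrS opprD addrACA.
exact: (subgroupD subK).
Qed.

(* Pigeonhole inside a coset of H. *)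
Lemma sumset_components H A a b h : is_subgroup [set` H] ->
    #|` H| < #|` A `&` translate a H| + #|` A `&` translate b H| ->
  h \in H -> (a + b + h)%R \in sumset A A.
Proof.
move=> subH ltH hH; apply/negPn/negP => nS.
move: ltH; apply/negP; rewrite -leqNgt -(card_translate a H).
pose V : {fset G} := [fset (a + b + h - v)%R | v in A `&` translate b H].
have -> : #|` A `&` translate b H| = #|` V|.
  by rewrite card_fset_image // => u v /addrI /oppr_inj.
apply: leq_cardD; first exact: fsubsetIr.
  apply/fsubsetP=> z /imfsetP[v /=]; rewrite inE mem_translate => /andP[_ vH] ->.
  rewrite mem_translate.
  have -> : (a + b + h - v - a = h - (v - b))%R.
    by rewrite opprB -!addrA addrC -!addrA addNr addr0 addrCA [(b - v)%R]addrC.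
  exact: (subgroupB subH hH vH).
move=> z; rewrite inE => /andP[zA _] /imfsetP[v /=]; rewrite inE => /andP[vA _] e.
by case/negP: nS; rewrite -[(a + b + h)%R](subrK v) -e mem_sumset.
Qed.

End IteratedSumsets.

(** * Periodicity for non-deserts and for trivial atoms *)

Section Deserts.
Variables (G : zmodType) (A : {fset G}).
Hypothesis A_neq0 : A != fset0.
Hypothesis A_ncoset : ~ is_coset_of (diffgroup A) A.
Implicit Types (X Y Z : {fset G}) (a b x y z : G).

Local Notation H := (atom0 A).
Local Notation kappa := (excess A H).

Let subH : is_subgroup [set` H] := atom0_subgroup A_neq0 A_ncoset.
Let subK : is_subgroup (diffgroup A) := diffgroup_subgroup A.

Lemma atom0D x y : x \in H -> y \in H -> (x + y)%R \in H.
Proof. by move=> xH yH; apply: (subgroupD subH xH yH). Qed.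

Lemma atom0B x y : x \in H -> y \in H -> (x - y)%R \in H.
Proof. by move=> xH yH; apply: (subgroupB subH xH yH). Qed.

Lemma atom0N x : x \in H -> (- x)%R \in H.
Proof. by move=> xH; apply: (subgroupN subH xH). Qed.

(** Every component fills more than half of its coset, so the first two summands already yield a
    full coset of H. *)
Lemma ndesert_ksumset k z h : ~ desert A -> z \in ksumset k.+2 A ->
  h \in H -> (z + h)%R \in ksumset k.+2 A.
Proof.
move=> ndes /sumsetP[a [_ [aA /sumsetP[b [w [bA wA ->]]] ->]]] hH.
have big c : c \in A -> #|` H| < 2 * #|` A `&` translate c H|.
  move=> cA; rewrite ltnNge; apply/negP => le_c; apply: ndes.
  exists (A `&` translate c H); split=> //; split; last by exists c.
  apply/fset0Pn; exists c; rewrite inE cA mem_translate subrr.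
  exact: (subgroup0 subH).
have -> : (a + (b + w) + h = a + b + h + w)%R by rewrite addrA [LHS]addrAC.
rewrite 2!ksumsetE sumsetA; apply: mem_sumset => //.
by apply: (sumset_components subH) => //; have := big _ aA; have := big _ bA; lia.
Qed.

Lemma atom0_trivial_ndesert : H = [fset 0%R] -> ~ desert A.
Proof.
move=> H1 [B [[/fset0Pn[b bB] _]]]; rewrite H1 cardfs1.
have : 0 < #|` B| by rewrite cardfs_gt0; apply/fset0Pn; exists b.
lia.
Qed.

(** With a trivial atom, kappa is |A| - 1: each new summand adds at least |A| - 1 elements unless
    the coset of the difference group is already filled. The hypothesis on |kA| excludes growth at
    every step. *)
Lemma atom0_trivial_ksumset k x g : H = [fset 0%R] -> x \in A ->
    #|` ksumset k A| + k <= k * #|` A| ->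
  diffgroup A g -> (x *+ k + g)%R \in ksumset k A.
Proof.
move=> H1 xA le_k Kg.
have A1 : 0 < #|` A| by rewrite cardfs_gt0.
suff [|] : 1 + k * #|` A|.-1 <= #|` ksumset k A| \/
    (forall g, diffgroup A g -> (x *+ k + g)%R \in ksumset k A); [nia|exact|].
elim: k {le_k} => [|k IHk]; first by left; rewrite mul0n cardfs1.
have [|||full] := @isoperimetric _ _ A_neq0 A_ncoset (ksumset k A) (x *+ k)%R x xA.
- by apply/fset0Pn; exists (x *+ k)%R; apply: mem_ksumset_mulrn.
- move=> y; apply: ksumset_coset => // a aA; exact: diffgroupB.
- rewrite H1 excess_fset1 sumsetC -ksumsetE => le_k1.
  case: IHk => [le_k|full]; first by left; lia.
  right=> g' Kg'; rewrite mulrS -addrA ksumsetE mem_sumset //; exact: full.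
- by right=> g' Kg'; rewrite mulrSr ksumsetE sumsetC; apply: full.
Qed.

(** * The desertic component B of A, with x a point of B *)

Section DeserticComponent.
Variables (B : {fset G}) (x : G).
Hypothesis des : desertic A B.
Hypothesis xB : x \in B.

Lemma mem_deserticE a : (a \in B) = (a \in A) && ((a - x)%R \in H).
Proof.
have [[_ [y eB]] _] := des.
have yx : (x - y)%R \in H by move: xB; rewrite eB inE mem_translate => /andP[].
rewrite eB inE mem_translate; case: (a \in A) => //=.
apply/idP/idP => aH.
  by rewrite -(subrKA y) -[(y - x)%R]opprB; apply: atom0B.
by rewrite -(subrKA x); apply: atom0D.
Qed.

Lemma desertic_sub : B `<=` A.
Proof. by apply/fsubsetP=> a; rewrite mem_deserticE => /andP[]. Qed.

Lemma desertic_base : x \in A.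
Proof. exact: (fsubsetP desertic_sub). Qed.

Lemma desertic_translate : B = A `&` translate x H.
Proof. by apply/fsetP=> a; rewrite mem_deserticE inE mem_translate. Qed.

Lemma translate_atom0_sub a : a \in A -> translate a H `<=` sumset H A.
Proof.
move=> aA; apply/fsubsetP=> z; rewrite mem_translate => zH.
by rewrite -[z](subrK a) mem_sumset.
Qed.

Lemma card_outer : #|` sumset H A `\` translate x H| = kappa.
Proof.
rewrite cardfsDS ?translate_atom0_sub ?desertic_base // card_translate.
by rewrite card_sumset_excess // addKn.
Qed.

Lemma card_A_desertic : #|` A| <= kappa + #|` B|.
Proof.
rewrite -card_outer; apply: leq_cardU; apply/fsubsetP=> a aA.
rewrite !inE mem_deserticE aA mem_translate /=.
case: ((a - x)%R \in H) => //=; rewrite orbF.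
by rewrite -[a]add0r mem_sumset //; apply: (subgroup0 subH).
Qed.

(** If B were A, then A - A would lie in H and H + A would contain a full coset of the difference
    group, against the admissibility of H. *)
Lemma desertic_proper : #|` B| < #|` A|.
Proof.
apply: fproper_ltn_card; rewrite fproperE desertic_sub /=.
apply/negP => /fsubsetP sAB.
have [[[admH _] _] _] := atom0P A_neq0 A_ncoset.
have [_ _ [g Kg]] := (admissibleP H desertic_base).1 admH.
case/negP; rewrite addrC mem_sumset ?desertic_base //.
apply: (diffgroup_sub subH _ Kg) => a b /sAB aB /sAB bB /=.
move: aB bB; rewrite !mem_deserticE => /andP[_ aH] /andP[_ bH].
by rewrite -(subrKA x) -[(x - b)%R]opprB; apply: atom0B.
Qed.

(* The subgroup generated by B - B has excess at most that of H, and the atom *)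
(* H has no smaller fragment.                                                 *)
Lemma diffgroup_desertic h : h \in H <-> diffgroup B h.
Proof.
have sB : (diffgroup B `<=` [set` H])%classic.
  apply: diffgroup_sub => // a b; rewrite !mem_deserticE => /andP[_ aH] /andP[_ bH] /=.
  by rewrite -(subrKA x) -[(x - b)%R]opprB; apply: atom0B.
split; last exact: sB.
have subB := diffgroup_subgroup B.
pose L : {fset G} := [fset y in H | `[< diffgroup B y >]].
have LE y : (y \in L) <-> diffgroup B y.
  rewrite !inE; split=> [/andP[_ /asboolP]//|By].
  by apply/andP; split; [apply: sB | apply/asboolP].
have sLH : L `<=` H by apply/fsubsetP=> y /LE; apply: sB.
have admL : admissible A L.
  have [[[admH _] _] _] := atom0P A_neq0 A_ncoset.
  apply: (admissible_sub A_neq0 _ sLH admH).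
  by apply/fset0Pn; exists 0%R; apply/LE; apply: subgroup0.
(* L + B stays in x + L, and L + (A \ B) stays in H + A outside x + H; the latter region has kappa
   elements. *)
have : #|` sumset L A| <= #|` translate x L| + #|` sumset H A `\` translate x H|.
  apply: leq_cardU; apply/fsubsetP=> _ /sumsetP[y [a [yL aA ->]]].
  rewrite in_fsetU in_fsetD !mem_translate -addrA.
  have yH := fsubsetP sLH _ yL.
  have [aB|aB] := boolP (a \in B).
    apply/orP; left; apply/LE; apply: (subgroupD subB); first exact/LE.
    exact: diffgroupB.
  apply/orP; right; rewrite mem_sumset // andbT.
  apply: contraNN aB => yaH; rewrite mem_deserticE aA /=.
  by rewrite -(addKr y (a - x)%R); apply: atom0D => //; apply: atom0N.
rewrite card_translate card_outer card_sumset_excess // leq_add2l.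
move/(leq_card_atom0 A_neq0 A_ncoset admL) => cL hH.
by apply/LE; have/eqP-> : L == H by rewrite eqEfcard sLH.
Qed.

(** The difference group of B is H, whose cosets have more than |H|/2 elements. *)
Lemma desertic_ncoset : ~ is_coset_of (diffgroup B) B.
Proof.
move=> [y eB]; have [[B0 _] le_B] := des.
have : #|` translate y H| <= #|` B|.
  apply/fsubset_leq_card/fsubsetP=> z; rewrite mem_translate.
  move=> /diffgroup_desertic zB; have : [set` B]%classic z by rewrite eB;
    exists (z - y)%R => //; rewrite addrC subrK.
  by [].
by rewrite card_translate; move: B0; rewrite -cardfs_gt0; lia.
Qed.

Lemma ksumset_outer k z : z \in ksumset k.+1 A ->
  z \in ksumset k.+1 B \/
  exists a w, [/\ a \in A, a \notin B, w \in ksumset k A & z = (a + w)%R].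
Proof.
elim: k z => [|k IHk] z /sumsetP[a [w [aA wA ->]]];
  (have [aB|aB] := boolP (a \in B); last by right; exists a, w).
  by left; rewrite ksumsetE mem_sumset.
have [wB|[b [v [bA bB vA ->]]]] := IHk _ wA.
  by left; rewrite ksumsetE mem_sumset.
right; exists b, (a + v)%R; split=> //; last by rewrite addrCA.
by rewrite ksumsetE mem_sumset.
Qed.

Hypothesis H_neq1 : H != [fset 0%R].

(** The holes of A in the distinct cosets a + H and x + H number at most |H| - 2 together, out of
    2|H| points. *)
Lemma card_component_desertic a : a \in A -> a \notin B ->
  #|` H| + 2 <= #|` A `&` translate a H| + #|` B|.
Proof.
move=> aA aB.
have le_k := leq_excess_atom0 A_neq0 A_ncoset H_neq1.
have xA := desertic_base.
rewrite desertic_translate.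
set U := translate a H; set V := translate x H.
have cU := cardfsID A U; have cV := cardfsID A V.
rewrite ![_ `&` A]fsetIC !card_translate in cU cV.
have cUV : #|` U `\` A| + #|` V `\` A| <= #|` (U `\` A) `|` (V `\` A)|.
  apply: leq_cardD; rewrite ?fsubsetUl ?fsubsetUr // => z.
  rewrite !inE !mem_translate => /andP[_ zU] /andP[_ zV].
  case/negP: aB; rewrite mem_deserticE aA /=.
  by rewrite -(subrKA z) addrC -[(a - z)%R]opprB; apply: atom0B.
have : #|` A| + #|` (U `\` A) `|` (V `\` A)| <= #|` sumset H A|.
  apply: leq_cardD.
  - apply/fsubsetP=> z zA; apply: (fsubsetP (translate_atom0_sub zA)).
    by rewrite mem_translate subrr; apply: (subgroup0 subH).
  - by rewrite fsubUset !(fsubset_trans (fsubsetDl _ _)) ?translate_atom0_sub.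
  - by move=> z zA; rewrite !inE zA.
rewrite card_sumset_excess //; lia.
Qed.

(** It suffices to add the component of a to that of another summand b. If b is in B, the previous
    bound applies as it stands; if not, both components have at least |H| + 2 - |B| elements, and
    2|B| <= |H|. *)
Lemma ksumset_outer_periodic k a w h :
    a \in A -> a \notin B -> w \in ksumset k.+1 A -> h \in H ->
  (a + w + h)%R \in ksumset k.+2 A.
Proof.
move=> aA aB /sumsetP[b [v [bA vA ->]]] hH.
have -> : (a + (b + v) + h = a + b + h + v)%R by rewrite addrA [LHS]addrAC.
rewrite 2!ksumsetE sumsetA; apply: mem_sumset => //.
apply: (sumset_components subH) => //; have ca := card_component_desertic aA aB.
have [_ le_B] := des.
have [bB|bB] := boolP (b \in B); last first.
  by have := card_component_desertic bA bB; lia.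
suff -> : A `&` translate b H = B by lia.
move: bB; rewrite mem_deserticE => /andP[_ bH].
apply/fsetP=> c; rewrite mem_deserticE inE mem_translate; case: (c \in A) => //=.
apply/idP/idP => cH; first by rewrite -(subrKA b); apply: atom0D.
by rewrite -(subrKA x) -[(x - b)%R]opprB; apply: atom0B.
Qed.

(** * The case where only sums of elements of B reach the coset of H containing them *)

Section UniqueSum.
Variable k : nat.
Hypothesis uniq_sum : forall a w, a \in A -> a \notin B ->
  w \in ksumset k A -> (a + w - x *+ k.+1)%R \notin H.

(** Each summand adds kappa elements by the isoperimetric inequality, unless H + jA + A fills its
    coset of the difference group; there the uniqueness hypothesis exhibits kappa new elements
    directly. *)
Lemma leq_card_ksumset_atom0 j : j <= k.+1 ->
  #|` H| + j * kappa <= #|` sumset H (ksumset j A)|.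
Proof.
have xA := desertic_base.
have sK a : a \in A -> diffgroup A (a - x)%R by move=> aA; apply: diffgroupB.
have HK h : h \in H -> diffgroup A h by apply: atom0_diffgroup.
elim: j => [_|j IHj lt_jk].
  by rewrite mul0n addn0 leq_card_sumset //; apply/fset0Pn; exists 0%R; rewrite inE.
(* Padding w with k - j copies of x reduces uniqueness for j + 1 summands to the hypothesis. *)
have uniq_j a w : a \in A -> a \notin B -> w \in ksumset j A ->
    (a + w - x *+ j.+1)%R \notin H.
  move=> aA aB wA.
  have := uniq_sum aA aB (_ : (w + x *+ (k - j))%R \in ksumset k A).
  rewrite -{4}(subnKC (_ : j <= k)) // -addSn mulrnDr addrA.
  rewrite [(x *+ j.+1 + _)%R]addrC addrKA; apply.
  by rewrite -{2}(subnKC (_ : j <= k)) // mem_ksumsetD // mem_ksumset_mulrn.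
set X := sumset H (ksumset j A) in IHj.
have XA : sumset X A = sumset H (ksumset j.+1 A).
  by rewrite -sumsetA [sumset _ A]sumsetC.
have X_coset y : y \in X -> diffgroup A (y - x *+ j)%R.
  case/sumsetP=> h [w [hH wA ->]]; rewrite -addrA.
  by apply: (subgroupD subK); [apply: HK | apply: ksumset_coset wA].
have IH : #|` H| + j * kappa <= #|` X| by apply: IHj; apply: ltnW.
have [||full] := isoperimetric A_neq0 A_ncoset xA _ X_coset.
- apply/fset0Pn; exists (0 + x *+ j)%R; apply: mem_sumset.
    exact: (subgroup0 subH).
  exact: mem_ksumset_mulrn.
- by rewrite XA; lia.
rewrite -XA.
pose p : G := (x *+ j + x)%R.
(* Y reflects the part of H + A outside x + H. It lies in the filled coset, and a point common to Y
   and x + X would write p, up to H, as a sum with a term outside B. *)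
pose Y : {fset G} := [fset (p + (x - u))%R | u in sumset H A `\` translate x H].
have cY : #|` Y| = kappa.
  by rewrite card_fset_image ?card_outer // => u v /addrI /addrI /oppr_inj.
have : #|` translate x X| + #|` Y| <= #|` sumset X A|.
  apply: leq_cardD.
  - apply/fsubsetP=> z; rewrite mem_translate => zX.
    by rewrite -[z](subrK x) mem_sumset.
  - apply/fsubsetP=> z /imfsetP[u /=]; rewrite inE => /andP[_].
    case/sumsetP=> h [a [hH aA ->]] ->; apply: full.
    rewrite opprD addrCA; apply: (subgroupD subK); last exact: diffgroupB.
    exact: (subgroupN subK (HK _ hH)).
  - move=> z; rewrite mem_translate => /sumsetP[h' [w [h'H wA e']]].
    case/imfsetP=> u /=; rewrite inE mem_translate => /andP[uN].
    case/sumsetP=> h [a [hH aA ue]] e.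
    have aB : a \notin B.
      apply: contraNN uN; rewrite mem_deserticE ue => /andP[_ aH].
      by rewrite -addrA; apply: atom0D.
    case/negP: (uniq_j _ _ aA aB wA); rewrite mulrSr -/p.
    have -> : p = (a + w + (h + h'))%R.
      rewrite -[p](addrK (x - u)%R) -e opprB addrA [LHS]addrAC e' ue.
      by rewrite [LHS]addrACA [LHS]addrC [(w + a)%R]addrC [(h' + h)%R]addrC.
    by rewrite opprD addrA subrr sub0r; apply/atom0N/atom0D.
rewrite card_translate cY; lia.
Qed.

Lemma uniq_sum_card : 0 < k -> #|` ksumset k.+1 A| + k.+1 <= k.+1 * #|` A| ->
  #|` ksumset k.+1 B| + k.+1 <= k.+1 * #|` B|.
Proof.
move=> k0 le_k; have leA := card_A_desertic.
have leH := leq_card_ksumset_atom0 (leqnn _).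
suff : #|` sumset H (ksumset k.+1 A)| + #|` ksumset k.+1 B|
    <= #|` H| + #|` ksumset k.+1 A| by nia.
pose V := translate (x *+ k.+1)%R H.
pose W := sumset H (ksumset k.+1 A) `\` V.
(* Outside V every sum has a term outside B, hence comes with its coset of H; so W lies in the
   sumset of A, while the sumset of B lies in V. *)
have leW : #|` W| + #|` ksumset k.+1 B| <= #|` ksumset k.+1 A|.
  apply: leq_cardD; last 2 first.
  - exact/ksumsetS/desertic_sub.
  - move=> z; rewrite inE mem_translate => /andP[zN _] zB; case/negP: zN.
    apply: (@ksumset_coset _ [set` H] k.+1 B) => //.
    by move=> b; rewrite mem_deserticE => /andP[].
  apply/fsubsetP=> z; rewrite inE mem_translate => /andP[zN].
  case/sumsetP=> h [w [hH wA ze]]; rewrite ze addrC.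
  have [wB|[a [v [aA aB vA ->]]]] := ksumset_outer wA; last first.
    by case: k k0 vA => // k' _ vA; apply: ksumset_outer_periodic.
  case/negP: zN; rewrite ze -addrA; apply: atom0D => //.
  apply: (@ksumset_coset _ [set` H] k.+1 B) => //.
  by move=> b; rewrite mem_deserticE => /andP[].
have : #|` sumset H (ksumset k.+1 A)| <= #|` V| + #|` W|.
  by apply: leq_cardU; apply/fsubsetP=> z zS; rewrite !inE zS andbT orbN.
rewrite card_translate; lia.
Qed.

End UniqueSum.

(* If some sum which is not in kB lies in the coset of H containing kB, then  *)
(* kA contains that coset; otherwise kB inherits the hypothesis on kA.        *)
Lemma desertic_ksumset (M : {fset G}) k : M `<=` H ->
    #|` ksumset k A| + k <= k * #|` A| ->
    (#|` ksumset k B| + k <= k * #|` B| ->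
     forall z m, z \in ksumset k B -> m \in M -> (z + m)%R \in ksumset k B) ->
  forall z m, z \in ksumset k A -> m \in M -> (z + m)%R \in ksumset k A.
Proof.
move=> /fsubsetP sMH le_k; have := small_ksumset_gt1 le_k.
case: k le_k => [|[|k]] // le_k _ perB z m zA mM.
have mH := sMH _ mM.
have [zB|[a [w [aA aB wA ->]]]] := ksumset_outer zA; last first.
  exact: ksumset_outer_periodic.
have [[a [w [aA aB wA awH]]]|nex] := pselect (exists a w,
    [/\ a \in A, a \notin B, w \in ksumset k.+1 A & (a + w - x *+ k.+2)%R \in H]).
  have zH : (z - x *+ k.+2)%R \in H.
    apply: (@ksumset_coset _ [set` H] k.+2 B) => //.
    by move=> b; rewrite mem_deserticE => /andP[].
  have -> : (z + m = a + w + ((z - x *+ k.+2) - (a + w - x *+ k.+2) + m))%R.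
    by rewrite opprB subrKA addrA [(a + w + _)%R]addrC subrK.
  by apply: ksumset_outer_periodic => //; apply: atom0D => //; apply: atom0B.
apply: (fsubsetP (ksumsetS _ desertic_sub)); apply: perB => //.
apply: uniq_sum_card => // a w aA aB wA; apply/negP=> awH.
by apply: nex; exists a, w.
Qed.

End DeserticComponent.
End Deserts.

(** * The desert sequence and its sub-atom *)

Section Subatoms.
Variable G : zmodType.
Implicit Types (A B M : {fset G}).

Definition desert_len_spec A l : Prop :=
  ~ desert (desert_seq A l) /\ (forall i, i < l -> desert (desert_seq A i)).

(** The sub-atom with the length of the sequence as a parameter, so that the induction avoids the
    choice made in [desert_len]. *)
Definition subatom_at A l : {fset G} :=
  if atom0 (desert_seq A l) != [fset 0%R] then atom0 (desert_seq A l)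
  else atom0 (desert_seq A l.-1).

Lemma desert_seqS A i :
  desert_seq A i.+1 = desert_seq (desertic_component A) i.
Proof. exact: iterSr. Qed.

Lemma desert_len_specS A l : desert A ->
  desert_len_spec (desertic_component A) l -> desert_len_spec A l.+1.
Proof.
by move=> desA [ndes des]; split=> [|[|i] lt_il] //; rewrite desert_seqS //; apply: des.
Qed.

Lemma subatom_atS A l : atom0 (desertic_component A) != [fset 0%R] ->
  subatom_at A l.+1 = subatom_at (desertic_component A) l.
Proof.
move=> B1; rewrite /subatom_at; case: l => [|l]; first by rewrite /= B1.
by rewrite !succnK !desert_seqS.
Qed.

Lemma desert_len_eq A l : desert_len_spec A l -> desert_len A = l.
Proof.
move=> specl; apply: xget_unique => // i [ndes_i des_i]; case: specl => ndes des.
by have [/des //|/des_i //|//] := ltngtP i l.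
Qed.

(** Strong induction on |A|, passing to the desertic component. The inclusion of M in the difference
    group is carried along because, applied to B, it says that M lies in H. *)
Lemma subatom_ksumset A : A != fset0 -> ~ is_coset_of (diffgroup A) A ->
    atom0 A != [fset 0%R] ->
  exists l, let M := subatom_at A l in
    [/\ desert_len_spec A l, 0%R \in M, (forall m, m \in M -> diffgroup A m)
      & forall k, #|` ksumset k A| + k <= k * #|` A| ->
        forall z m, z \in ksumset k A -> m \in M -> (z + m)%R \in ksumset k A].
Proof.
have [n] := ubnP #|` A|; elim: n A => // n IHn A ltAn A0 Anc H1.
have [_ H0] := atom0P A0 Anc.
have [desA|ndesA] := pselect (desert A); last first.
  exists 0; rewrite /= /subatom_at /= H1; split=> //; first exact: atom0_diffgroup.
  move=> k /small_ksumset_gt1; case: k => [|[|k]] // _ z m zA mH.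
  exact: ndesert_ksumset.
have desB : desertic A (desertic_component A) by apply: xgetPex desA.
set B := desertic_component A in desB.
have [[B0 _] _] := desB; have [x xB] := fset0Pn _ B0.
have Bnc := desertic_ncoset A0 Anc desB xB.
have HE := diffgroup_desertic A0 Anc desB xB.
have [B1|B1] := eqVneq (atom0 B) [fset 0%R].
  (* The sequence stops at B, whose atom is trivial, so the sub-atom is the atom H of A; kB is a
     full coset of H. *)
  exists 1; rewrite /= /subatom_at /= -/B B1 eqxx /=; split=> //.
  - split; first exact: atom0_trivial_ndesert.
    by case.
  - exact: atom0_diffgroup.
  move=> k le_k; apply: (desertic_ksumset A0 Anc desB xB H1 (fsubset_refl _) le_k).
  move=> le_kB z m zB mH; rewrite -[(z + m)%R](subrKC (x *+ k)%R).
  apply: atom0_trivial_ksumset => //.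
  rewrite addrAC; apply: (subgroupD (diffgroup_subgroup B)); last exact/HE.
  apply: ksumset_coset zB; first exact: diffgroup_subgroup.
  by move=> b bB; apply: diffgroupB.
have [|l [len_l M0 sM perM]] := IHn B _ B0 Bnc B1.
  by have := desertic_proper A0 Anc desB xB; lia.
exists l.+1; rewrite /= subatom_atS // -/B; split=> //.
- exact: desert_len_specS.
- by move=> m /sM /HE; apply: atom0_diffgroup.
move=> k le_k; apply: (desertic_ksumset A0 Anc desB xB H1 _ le_k); last exact: perM.
by apply/fsubsetP=> m /sM /HE.
Qed.

End Subatoms.

Theorem theorem16 (G : zmodType) (k : nat) (S : {fset G})
    (S_neq0 : S != fset0)
    (S_ncoset : forall H : set G, is_subgroup H -> ~ is_coset_of H S)
    (kappa_le : kappa1 S <= #|` S| - 2)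
    (kS_le : #|` ksumset k S| <= k * #|` S| - k) :
  sumset (ksumset k S) (subatom S) = ksumset k S.
Proof.
have S_nc : ~ is_coset_of (diffgroup S) S.
  exact/S_ncoset/diffgroup_subgroup.
(* A singleton is a coset of {0}. With |S| > 1 the truncated subtractions in the hypotheses are true
   ones. *)
have S_gt1 : 1 < #|` S|.
  rewrite ltn_neqAle cardfs_gt0 S_neq0 andbT eq_sym; apply/negP => /cardfs1P[s Ss].
  apply: (S_ncoset [set 0%R]%classic).
    by split=> // x y -> ->; rewrite subrr.
  exists s; rewrite Ss eqEsubset; split=> [x /=|_ [h -> <-] /=]; rewrite inE.
    by move/eqP->; exists 0%R => //; rewrite addr0.
  by rewrite addr0.
(* A trivial atom would give [kappa1 S] the value |S| - 1. *)
have H1 : atom0 S != [fset 0%R].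
  apply/negP => /eqP H1; have [[[_ kH] _] _] := atom0P S_neq0 S_nc.
  by move: kH; rewrite H1 excess_fset1; lia.
have [l [len_l M0 _ perM]] := subatom_ksumset S_neq0 S_nc H1.
have -> : subatom S = subatom_at S l by rewrite /subatom (desert_len_eq len_l).
apply/fsetP=> z; apply/sumsetP/idP => [[y [m [yS mM ->]]]|zS].
  by apply: perM => //; nia.
by exists z, 0%R; rewrite addr0.
Qed.
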